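(* Let $\mathcal T^{(1)},\mathcal T^{(2)}$ be Galton–Watson trees as below and suppose $\Phi_1\le\Phi_2$, i.e. $\Phi_1(t)\le\Phi_2(t)$ for all $t\in(0,1)$. Then: (a) if $\alpha<0$, then $\mu_1(\alpha)\le\mu_2(\alpha)$; (b) if $0<\alpha<\tfrac12$, then $\mu_1(\alpha)\ge\mu_2(\alpha)$; (c) $\mu_1'\ge\mu_2'$.
   Context: For $j=1,2$, let $\xi_j$ be a random variable with values in $\{0,1,2,\dots\}$ with $\mathbb E\xi_j=1$ and $0<\operatorname{Var}\xi_j<\infty$, with probability generating function $\Phi_j(t)=\mathbb E t^{\xi_j}$, and let $\mathcal T^{(j)}$ be a Galton–Watson tree with offspring distribution $\xi_j$. For real $\alpha<1/2$, $\mu_j(\alpha):=\mathbb E|\mathcal T^{(j)}|^\alpha$ and $\mu_j':=\mathbb E\log|\mathcal T^{(j)}|$, where $|\cdot|$ is the number of vertices. *)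

(* Defs.v *)
From HB Require Import structures.
From mathcomp Require Import all_boot all_order all_algebra.
From mathcomp Require Import all_classical all_reals all_analysis.
Set Implicit Arguments. Unset Strict Implicit. Unset Printing Implicit Defensive.
Import Order.TTheory GRing.Theory Num.Theory.
Local Open Scope ring_scope.

Inductive ptree := PNode of seq ptree.

Fixpoint psize (t : ptree) : nat :=
  let: PNode ts := t in (foldr (fun s acc => psize s + acc) 0 ts).+1.

Fixpoint ptree_enc (t : ptree) : GenTree.tree unit :=
  let: PNode ts := t in GenTree.Node 0 (map ptree_enc ts).
Fixpoint ptree_dec (g : GenTree.tree unit) : ptree :=
  match g with
  | GenTree.Leaf _ => PNode [::]
  | GenTree.Node _ gs => PNode (map ptree_dec gs)
  end.
Lemma ptree_encK_aux (t : ptree) : ptree_dec (ptree_enc t) = t.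
Proof.
move: t; fix IH 1 => -[ts] /=; congr PNode.
elim: ts => [|t ts IHts] //=; by rewrite IH IHts.
Qed.
Lemma ptree_encK : cancel ptree_enc ptree_dec.
Proof. exact: ptree_encK_aux. Qed.
HB.instance Definition _ := Countable.copy ptree (can_type ptree_encK).

Section GW.
Variable R : realType.

(* Probability that a Galton--Watson tree with offspring law p equals the
   finite plane tree t: product over vertices of p(number of children). *)
Fixpoint gw_weight (p : nat -> R) (t : ptree) : R :=
  let: PNode ts := t in p (size ts) * foldr (fun s acc => gw_weight p s * acc) 1 ts.

Definition critical_offspring (p : nat -> R) : Prop :=
  (forall k, 0 <= p k) /\
  (\sum_(0 <= k <oo) (p k)%:E = 1%E)%E /\
  (\sum_(0 <= k <oo) (k%:R * p k)%:E = 1%E)%E /\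
  (0 < \sum_(0 <= k <oo) (((k%:R - 1) ^+ 2) * p k)%:E < +oo)%E.

Definition pgf (p : nat -> R) (t : R) : \bar R :=
  (\sum_(0 <= k <oo) (p k * t ^+ k)%:E)%E.

(* mu(alpha) = E |T|^alpha,  mu' = E log |T| (T is a.s. finite, critical case) *)
Definition gw_mu (p : nat -> R) (alpha : R) : \bar R :=
  \esum_(t in [set: ptree]) ((psize t)%:R `^ alpha * gw_weight p t)%:E.
Definition gw_mu' (p : nat -> R) : \bar R :=
  \esum_(t in [set: ptree]) (ln (psize t)%:R * gw_weight p t)%:E.
End GW.

(* Main.v *)
(* The generating function Y(x) = E x^|T| is the least nonnegative solution of
   y = x Phi(y), so Phi_1 <= Phi_2 gives Y_1 <= Y_2 on (0,1); criticality makes the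
   trees almost surely finite, that is Y_j(1) = 1, so 1 - Y_1 >= 1 - Y_2 as well.
   For b > 0 the power n^(-b) is a positive mixture of the functions e^(-u n), and
   n^b with 0 < b < 1 is one of the functions 1 - e^(-u n). Instead of the Gamma
   integral, the mixture is taken over the geometric progression u = e^(k d),
   k in Z: it reproduces the power up to a log-periodic factor which tends to a
   constant as d -> 0. The logarithm is the limit of (1 - n^(-b)) / b. *)
Require Import Defs.
From HB Require Import structures.
From mathcomp Require Import all_boot all_order all_algebra.
From mathcomp Require Import finmap.
From mathcomp Require Import all_classical all_reals all_analysis.
From mathcomp Require Import ring lra.
Import Order.TTheory GRing.Theory Num.Theory.
Local Open Scope ring_scope.

Section GaltonWatson.
Set Implicit Arguments. Unset Strict Implicit. Unset Printing Implicit Defensive.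
Local Open Scope classical_set_scope.
Local Open Scope ereal_scope.
Context {R : realType}.

(** * Unordered sums of nonnegative terms *)

Section Esum.
Context {T : choiceType}.
Implicit Types (I : set T) (f : T -> \bar R).

Lemma esumZl I f (x : R) : (0 <= x)%R -> (forall i, I i -> 0 <= f i) ->
  \esum_(i in I) (x%:E * f i) = x%:E * \esum_(i in I) f i.
Proof.
have le_scale (y : R) g : (0 <= y)%R -> (forall i, I i -> 0 <= g i) ->
    \esum_(i in I) (y%:E * g i) <= y%:E * \esum_(i in I) g i.
  move=> y0 g0; apply: ge_ereal_sup => _ [X [finX XI] <-].
  rewrite fsbig_finite//= big_seq -ge0_sume_distrr -?big_seq; last first.
    by move=> i; rewrite in_fset_set// inE => /XI/g0.
  rewrite lee_wpmul2l ?lee_fin//; apply: esum_ge.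
  by exists X => //; rewrite fsbig_finite.
rewrite le_eqVlt => /predU1P[<- f0|x0 f0].
  by rewrite mul0e esum1// => i _; rewrite mul0e.
apply/eqP; rewrite eq_le le_scale ?(ltW x0)//=.
(* The reverse inequality is the same bound for the factor [x^-1] and the family [x%:E * f i]. *)
rewrite -lee_pdivlMl//; apply: le_trans (le_scale _ _ _ _); last 2 first.
- by rewrite invr_ge0 ltW.
- by move=> i Ii; rewrite mule_ge0 ?lee_fin ?(ltW x0)// f0.
by apply: le_esum => i _; rewrite muleA -EFinM mulVf ?gt_eqF// mul1e.
Qed.

Lemma subset_esum I J f : I `<=` J -> \esum_(i in I) f i <= \esum_(i in J) f i.
Proof.
move=> IJ; apply: ereal_sup_le => _ [X [finX XI] <-].
by exists X => //; split=> // x /XI/IJ.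
Qed.

Lemma esum_ge_term I f i : (forall j, I j -> 0 <= f j) -> I i ->
  f i <= \esum_(j in I) f j.
Proof.
move=> f0 Ii; rewrite -(@esum_set1 _ _ i f (f0 _ Ii)).
by apply: subset_esum => _ ->.
Qed.

End Esum.

Lemma esum_exchange (T U : choiceType) (f : T -> U -> \bar R) :
  (forall t u, 0 <= f t u) ->
  \esum_(t in [set: T]) \esum_(u in [set: U]) f t u =
  \esum_(u in [set: U]) \esum_(t in [set: T]) f t u.
Proof.
move=> f0; rewrite !esum_esum//.
apply: (reindex_esum _ _ (fun x : U * T => (x.2, x.1))); split=> //.
- by move=> [a b] [c d] _ _ [-> ->].
- by move=> [a b] _; exists (b, a).
Qed.

(** The two sums against [f] and [1 - f] add up to the total mass 1, so all are finite and
    subtraction reverses the comparison. *)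
Lemma esum_oneminus (T : choiceType) (f w1 w2 : T -> R) :
  (forall t, 0 <= f t <= 1)%R -> (forall t, 0 <= w1 t)%R ->
  (forall t, 0 <= w2 t)%R ->
  \esum_(t in [set: T]) (w1 t)%:E = 1 -> \esum_(t in [set: T]) (w2 t)%:E = 1 ->
  \esum_(t in [set: T]) (f t * w1 t)%:E <= \esum_(t in [set: T]) (f t * w2 t)%:E ->
  \esum_(t in [set: T]) ((1 - f t) * w2 t)%:E <=
  \esum_(t in [set: T]) ((1 - f t) * w1 t)%:E.
Proof.
move=> f01 w10 w20 S1 S2.
have f0 t : (0 <= f t)%R by case/andP: (f01 t).
have f1 t : (0 <= 1 - f t)%R by rewrite subr_ge0; case/andP: (f01 t).
have split w : (forall t, 0 <= w t)%R ->
    \esum_(t in [set: T]) (w t)%:E = \esum_(t in [set: T]) (f t * w t)%:E +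
      \esum_(t in [set: T]) ((1 - f t) * w t)%:E.
  move=> w0; rewrite -esumD; last 2 first.
  - by move=> t _; rewrite lee_fin mulr_ge0.
  - by move=> t _; rewrite lee_fin mulr_ge0.
  by apply: eq_esum => t _; rewrite -EFinD -mulrDl addrC subrK mul1r.
have fin w g : (forall t, 0 <= w t)%R -> (forall t, 0 <= g t)%R ->
    (forall t, g t <= 1)%R -> \esum_(t in [set: T]) (w t)%:E = 1 ->
    exists2 r : R, (0 <= r)%R & \esum_(t in [set: T]) (g t * w t)%:E = r%:E.
  move=> w0 g0 g1 S.
  have : \esum_(t in [set: T]) (g t * w t)%:E <= 1.
    by rewrite -S; apply: le_esum => t _; rewrite lee_fin ler_piMl.
  have : 0 <= \esum_(t in [set: T]) (g t * w t)%:E.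
    by apply: esum_ge0 => t _; rewrite lee_fin mulr_ge0.
  by case: (\esum_(t in _) _) => // r; rewrite !lee_fin; exists r.
have [||r1 r10 E1] := fin w1 f w10 f0; [by move=> t; case/andP: (f01 t)|by []|].
have [||r2 r20 E2] := fin w2 f w20 f0; [by move=> t; case/andP: (f01 t)|by []|].
have [||s1 s10 F1] := fin w1 _ w10 f1; [by move=> t; have:= f0 t; lra|by []|].
have [||s2 s20 F2] := fin w2 _ w20 f1; [by move=> t; have:= f0 t; lra|by []|].
move: (split _ w10) (split _ w20); rewrite S1 S2 E1 E2 F1 F2 -!EFinD !lee_fin.
move=> [e1] [e2]; lra.
Qed.

(** * Decomposition of plane trees at the root *)

Definition seqs_of (T : choiceType) (A : set T) (k : nat) : set (seq T) :=
  [set s | size s = k /\ forall t, t \in s -> A t].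

(** Independence of the [k] subtrees of a root: splitting off the head of the list yields one factor
    [S] per subtree. *)
Lemma esum_seqs_of (T : choiceType) (A : set T) (F : T -> R) (S : R) k :
  (forall t, 0 <= F t)%R -> \esum_(t in A) (F t)%:E = S%:E ->
  \esum_(s in seqs_of A k) (\prod_(t <- s) F t)%:E = (S ^+ k)%:E.
Proof.
move=> F0 FS; elim: k => [|k IH].
  rewrite (_ : seqs_of A 0 = [set [::]]) ?esum_set1 ?big_nil ?lee_fin//.
  apply/seteqP; split=> [s [/size0nil]|s ->] //; split=> // t; rewrite in_nil//.
rewrite (reindex_esum (A `*`` (fun=> seqs_of A k)) _ (fun x => x.1 :: x.2)).
  transitivity (\esum_(t in A) \esum_(s in seqs_of A k)
      (F t)%:E * (\prod_(t <- s) F t)%:E).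
    rewrite esum_esum; last first.
      by move=> t s _ _; rewrite mule_ge0 ?lee_fin ?prodr_ge0.
    by apply: eq_esum => -[t s] _ /=; rewrite big_cons.
  transitivity (\esum_(t in A) ((S ^+ k)%:E * (F t)%:E)).
    apply: eq_esum => t _; rewrite esumZl//; first by rewrite IH muleC.
    by move=> s _; rewrite lee_fin prodr_ge0.
  rewrite esumZl ?FS -?EFinM -?exprSr//; last by move=> t _; rewrite lee_fin.
  have S0 : (0 <= S)%R.
    by rewrite -lee_fin -FS; apply: esum_ge0 => t _; rewrite lee_fin.
  by rewrite exprn_ge0.
split.
- move=> [t s] [/= At [<- sA]]; split => //= u.
  by rewrite inE => /predU1P[->//|]; exact: sA.
- by move=> [t s] [t' s'] _ _ [-> ->].
- move=> [|t s] [//= [sk] tsA]; exists (t, s) => //; split=> /=.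
    by apply: tsA; rewrite mem_head.
  by split=> // u us; apply: tsA; rewrite inE us orbT.
Qed.

Definition trees_over (A : set ptree) : set ptree :=
  [set PNode ts | ts in [set ts : seq ptree | forall t, t \in ts -> A t]].

Lemma gw_weight_ge0 (a : nat -> R) : (forall k, 0 <= a k)%R ->
  forall t, (0 <= gw_weight a t)%R.
Proof.
move=> a0; fix IH 1 => -[ts] /=; apply: mulr_ge0 => //.
by elim: ts => //= t ts IHts; exact: mulr_ge0.
Qed.

(** Each vertex carries one factor [x], so x^|T| is absorbed into unnormalised offspring weights;
    the root decomposition is therefore stated for arbitrary nonnegative [a]. *)
Lemma gw_weight_scale (a : nat -> R) (x : R) t :
  gw_weight (fun k => x * a k)%R t = (x ^+ psize t * gw_weight a t)%R.
Proof.
move: t; fix IH 1 => -[ts] /=; rewrite exprS -!mulrA; congr (x * _)%R.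
rewrite mulrCA; congr (_ * _)%R; elim: ts => [|t ts IHts] /=; first by rewrite mul1r.
by rewrite IH IHts exprD mulrACA.
Qed.

(** The trees are sorted by the number [k] of children of the root, and [S ^+ k] is expanded as a
    sum over the lists of [k] subtrees. *)
Lemma esum_trees_over (a : nat -> R) (A : set ptree) (S : R) :
  (forall k, 0 <= a k)%R -> \esum_(t in A) (gw_weight a t)%:E = S%:E ->
  \esum_(t in trees_over A) (gw_weight a t)%:E =
  \sum_(0 <= k <oo) (a k * S ^+ k)%:E.
Proof.
move=> a0 AS; have w0 := gw_weight_ge0 a0.
have S0 : (0 <= S)%R.
  by rewrite -lee_fin -AS; apply: esum_ge0 => t _; rewrite lee_fin.
rewrite esum_image; last by move=> ts ts' _ _ [].
rewrite nneseries_esumT; last by move=> k; rewrite lee_fin mulr_ge0 ?exprn_ge0.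
under [RHS]eq_esum => k _.
  rewrite EFinM -(esum_seqs_of k w0 AS) -esumZl//; last first.
    by move=> s _; rewrite lee_fin prodr_ge0.
  over.
rewrite esum_esum; last by move=> k s _ _; rewrite lee_fin mulr_ge0// prodr_ge0.
rewrite (reindex_esum ([set: nat] `*`` seqs_of A) _ snd).
  by apply: eq_esum => -[k s] [_ [/= <- _]]; rewrite -EFinM unlock.
split.
- by move=> [k s] [_ [_]].
- by move=> [k s] [k' s']; rewrite !inE => -[_ [/= <- _]] [_ [/= <- _]] ->.
- by move=> s sA; exists (size s, s).
Qed.


(** * The generating function of the total progeny as a least fixed point *)

Definition gw_gf (p : nat -> R) (x : R) : \bar R :=
  \esum_(t in [set: ptree]) (x ^+ psize t * gw_weight p t)%:E.

Lemma psize_child t ts : t \in ts -> (psize t < psize (PNode ts))%N.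
Proof.
rewrite /= ltnS; elim: ts => //= u ts IHts; rewrite inE => /predU1P[->|/IHts].
  exact: leq_addr.
by move=> /leq_trans; apply; exact: leq_addl.
Qed.

Lemma pgf_scale (p : nat -> R) (x s : R) :
  (forall k, 0 <= p k)%R -> (0 <= x)%R -> (0 <= s)%R ->
  \sum_(0 <= k <oo) (x * p k * s ^+ k)%:E = x%:E * pgf p s.
Proof.
move=> p0 x0 s0; rewrite /pgf -nneseriesZl; last first.
  by move=> k _; rewrite lee_fin mulr_ge0 ?exprn_ge0.
by apply: eq_eseriesr => k _; rewrite -EFinM mulrA.
Qed.

Lemma gw_gf_fixed (p : nat -> R) (x y : R) :
  (forall k, 0 <= p k)%R -> (0 <= x)%R -> gw_gf p x = y%:E ->
  y%:E = x%:E * pgf p y.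
Proof.
move=> p0 x0 gfy; rewrite -pgf_scale//; last first.
  rewrite -lee_fin -gfy; apply: esum_ge0 => t _.
  by rewrite lee_fin mulr_ge0 ?exprn_ge0// gw_weight_ge0.
have a0 k : (0 <= x * p k)%R by rewrite mulr_ge0.
have gfE : \esum_(t in [set: ptree]) (gw_weight (fun k => x * p k)%R t)%:E = y%:E.
  by rewrite -gfy; apply: eq_esum => t _; rewrite gw_weight_scale.
rewrite -(esum_trees_over a0 gfE) -gfE; congr (esum _ _).
by apply/seteqP; split => // -[ts] _; exists ts.
Qed.

(** Minimality, by induction on a size cutoff: trees of size at most n+1 have root subtrees of size
    at most n, so the truncated sums satisfy S_(n+1) <= x Phi(S_n) <= x Phi(y) <= y. Any finite set
    of trees lies below some cutoff. *)
Lemma gw_gf_le (p : nat -> R) (x y : R) :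
  (forall k, 0 <= p k)%R -> (0 <= x)%R -> (0 <= y)%R ->
  x%:E * pgf p y <= y%:E -> gw_gf p x <= y%:E.
Proof.
move=> p0 x0 y0 supersol.
have a0 k : (0 <= x * p k)%R by rewrite mulr_ge0.
have w0 t : 0 <= (gw_weight (fun k => x * p k)%R t)%:E.
  by rewrite lee_fin gw_weight_ge0.
pose A n := [set t | (psize t <= n)%N].
have trunc n : \esum_(t in A n) (gw_weight (fun k => x * p k)%R t)%:E <= y%:E.
  elim: n => [|n IH].
    by rewrite esum1// => -[ts].
  have [S S0 SE] : exists2 S : R, (0 <= S)%R &
      \esum_(t in A n) (gw_weight (fun k => x * p k)%R t)%:E = S%:E.
    move: IH; have := esum_ge0 (S := A n) (fun t _ => w0 t).
    by case: (esum _ _) => // S; rewrite !lee_fin; exists S.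
  move: IH; rewrite SE lee_fin => Sy.
  apply: (@le_trans _ _ (\esum_(t in trees_over (A n))
      (gw_weight (fun k => x * p k)%R t)%:E)).
    apply: subset_esum => -[ts] tsn; exists ts => // t /psize_child.
    by move=> /leq_trans/(_ tsn); rewrite ltnS.
  rewrite (esum_trees_over a0 SE); apply: le_trans supersol.
  rewrite -pgf_scale//; apply: lee_nneseries => k _.
    by rewrite lee_fin mulr_ge0 ?exprn_ge0.
  by rewrite lee_fin ler_wpM2l// lerXn2r ?nnegrE.
apply: ge_ereal_sup => _ [X [finX _] <-].
pose n := (\max_(t <- fset_set X) psize t)%N.
apply: (le_trans _ (trunc n)).
under eq_fsbigr do rewrite -gw_weight_scale.
apply: ereal_sup_ubound; exists X => //; split => // t Xt.
by apply: leq_bigmax_seq => //; rewrite in_fset_set// inE.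
Qed.

(** * Critical offspring laws and almost sure finiteness *)

Section Critical.
Context {p : nat -> R} (p_crit : critical_offspring p).

Let p0 k : (0 <= p k)%R. Proof. by case: p_crit. Qed.
Let psum : \sum_(0 <= k <oo) (p k)%:E = 1. Proof. by case: p_crit => _ []. Qed.
Let pmean : \sum_(0 <= k <oo) (k%:R * p k)%:E = 1.
Proof. by case: p_crit => _ [_ []]. Qed.

(** Otherwise [p] lives on {0, 1}, where (k - 1)^2 + k = 1; then variance plus mean equals total
    mass, and the variance is 0. *)
Lemma critical_branching : exists2 k, (2 <= k)%N & (0 < p k)%R.
Proof.
apply: contrapT => nobranch.
have p2 k : p k.+2 = 0%R.
  apply/eqP; rewrite eq_le p0 andbT leNgt; apply/negP => pk.
  by apply: nobranch; exists k.+2.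
have : \sum_(0 <= k <oo) ((k%:R - 1) ^+ 2 * p k)%:E + 1 = 1.
  rewrite -[X in _ + X]pmean -nneseriesD; last 2 first.
  - by move=> k _ _; rewrite lee_fin mulr_ge0 ?sqr_ge0.
  - by move=> k _ _; rewrite lee_fin mulr_ge0.
  rewrite -[RHS]psum; apply: eq_eseriesr => -[|[|k]] _; rewrite -EFinD.
  - by congr EFin; ring.
  - by congr EFin; ring.
  - by rewrite p2 !mulr0 addr0.
case: p_crit => _ [_ [_]]; case: (limn _) => // v /andP[].
by rewrite lte_fin => v0 _; rewrite -EFinD => -[]; lra.
Qed.

Lemma pgf1 : pgf p 1 = 1.
Proof. by rewrite -psum; apply: eq_eseriesr => k _; rewrite expr1n mulr1. Qed.

Lemma pgf_le1 (x : R) : (0 <= x <= 1)%R -> pgf p x <= 1.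
Proof.
move=> /andP[x0 x1]; rewrite -pgf1; apply: lee_nneseries => k _.
  by rewrite lee_fin mulr_ge0 ?exprn_ge0.
by rewrite lee_fin ler_wpM2l// lerXn2r ?nnegrE.
Qed.

(** Bernoulli's inequality: the expression is the height of q^k above its tangent at 1. Averaged
    over [p], of mass and mean 1, it becomes Phi(q) - q. *)
Lemma bernoulli_gap (q : R) k : (0 <= q < 1)%R ->
  (0 <= q ^+ k - 1 + k%:R * (1 - q))%R.
Proof.
move=> /andP[q0 q1]; elim: k => [|k IH]; first by rewrite expr0; lra.
have qk : (q ^+ k <= 1)%R by rewrite exprn_ile1// ltW.
rewrite exprS -natr1; nra.
Qed.

Lemma bernoulli_gap_gt0 (q : R) k : (0 <= q < 1)%R -> (2 <= k)%N ->
  (0 < q ^+ k - 1 + k%:R * (1 - q))%R.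
Proof.
case: k => [|[|k]] // q01 _; have gap1 := bernoulli_gap k.+1 q01.
case/andP: q01 => q0 q1.
have qk : (q ^+ k.+1 < 1)%R by rewrite exprn_ilt1.
have gap : (0 < (1 - q) * (1 - q ^+ k.+1))%R by rewrite mulr_gt0// subr_gt0.
rewrite exprS -(natr1 k.+1).
(* Raising the exponent by one adds (1 - q)(1 - q^(k+1)) to the gap; this increment is positive. *)
have -> : (q * q ^+ k.+1 - 1 + (k.+1%:R + 1) * (1 - q) =
  (q ^+ k.+1 - 1 + k.+1%:R * (1 - q)) + (1 - q) * (1 - q ^+ k.+1) :> R)%R by ring.
by rewrite ltr_wpDl.
Qed.

(* The graph of the strictly convex [pgf p] lies above its tangent at [1],
   which is the diagonal since the mean is [1]. *)
Lemma pgf_gt (q : R) : (0 <= q < 1)%R -> q%:E < pgf p q.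
Proof.
move=> q01; have /andP[q0 q1] := q01.
have d0 k := bernoulli_gap k q01.
have [k k2 pk] := critical_branching.
have gap : 0 < \sum_(0 <= k <oo) (p k * (q ^+ k - 1 + k%:R * (1 - q)))%:E.
  apply: (@lt_le_trans _ _ (p k * (q ^+ k - 1 + k%:R * (1 - q)))%:E).
    by rewrite lte_fin mulr_gt0// bernoulli_gap_gt0.
  rewrite nneseries_esumT; last by move=> i; rewrite lee_fin mulr_ge0.
  by apply: (esum_ge_term (f := fun k => (p k * _)%:E)) => // i _;
    rewrite lee_fin mulr_ge0.
(* The identity Phi(q) - q = sum of the gaps, rearranged so that every series has nonnegative
   terms. *)
have : pgf p q + (1 - q)%:E =
    1 + \sum_(0 <= k <oo) (p k * (q ^+ k - 1 + k%:R * (1 - q)))%:E.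
  rewrite -[X in _ = X + _]psum -nneseriesD; last 2 first.
  - by move=> i _ _; rewrite lee_fin.
  - by move=> i _ _; rewrite lee_fin mulr_ge0.
  rewrite -[X in _ + X]mule1 -pmean -nneseriesZl; last first.
    by move=> i _; rewrite lee_fin mulr_ge0.
  rewrite -nneseriesD; last 2 first.
  - by move=> i _ _; rewrite lee_fin mulr_ge0 ?exprn_ge0.
  - by move=> i _ _; rewrite -EFinM lee_fin !mulr_ge0// subr_ge0 ltW.
  by apply: eq_eseriesr => i _; rewrite -EFinM -!EFinD; congr EFin; ring.
have := pgf_le1 (x := q); rewrite q0 ltW// => /(_ isT).
move: gap; case: (limn _) => [d|//|//]; case: (pgf p q) => [r|//|//].
  by rewrite !lte_fin -!EFinD => d_gt0 _ [E]; lra.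
by rewrite -EFinD.
Qed.

(** Since Phi(x) <= 1, the point [x] itself satisfies x Phi(x) <= x, and minimality applies. *)
Lemma gw_gf_fin (x : R) : (0 <= x <= 1)%R ->
  exists2 y : R, gw_gf p x = y%:E & (0 <= y <= x)%R.
Proof.
move=> /andP[x0 x1].
have : 0 <= gw_gf p x.
  by apply: esum_ge0 => t _; rewrite lee_fin mulr_ge0 ?exprn_ge0 ?gw_weight_ge0.
have : gw_gf p x <= x%:E.
  apply: gw_gf_le => //; rewrite -[leRHS]mule1 lee_wpmul2l ?lee_fin//.
  by rewrite pgf_le1 ?x0.
by case: gw_gf => // y; rewrite !lee_fin => yx y0; exists y; rewrite ?y0.
Qed.

(** The sum is a fixed point of Phi in [0, 1], and Phi(q) > q excludes every q < 1. *)
Lemma gw_weight_sum1 : \esum_(t in [set: ptree]) (gw_weight p t)%:E = 1.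
Proof.
have -> : \esum_(t in [set: ptree]) (gw_weight p t)%:E = gw_gf p 1.
  by apply: eq_esum => t _; rewrite expr1n mul1r.
have [|y gfy /andP[y0]] := gw_gf_fin (x := 1); first by rewrite ler01 lexx.
rewrite gfy le_eqVlt => /predU1P[-> //|y1].
have := gw_gf_fixed p0 ler01 gfy; rewrite mul1e => yE.
by have := pgf_gt (q := y); rewrite y0 y1 -yE ltxx => /(_ isT).
Qed.

End Critical.

(** The value y = Y_2(x) satisfies x Phi_1(y) <= x Phi_2(y) = y, so minimality bounds Y_1(x) by
    it. *)
Lemma gw_gf_mono (p1 p2 : nat -> R) (x : R) :
  critical_offspring p1 -> critical_offspring p2 ->
  (forall t : R, (0 < t < 1)%R -> pgf p1 t <= pgf p2 t) ->
  (0 < x < 1)%R -> gw_gf p1 x <= gw_gf p2 x.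
Proof.
move=> c1 c2 le12 /andP[x0 x1].
have [|y gfy /andP[y0 yx]] := gw_gf_fin c2 (x := x); first by rewrite !ltW.
have p10 : forall k, (0 <= p1 k)%R by case: c1.
have p20 : forall k, (0 <= p2 k)%R by case: c2.
have yE := gw_gf_fixed p20 (ltW x0) gfy.
have y1 := le_lt_trans yx x1.
(* The generating functions are compared only on the open interval, so y = 0 has to be excluded;
   Phi_2(y) > y >= 0 does it. *)
have y_gt0 : (0 < y)%R.
  rewrite -lte_fin yE mule_gt0 ?lte_fin//; apply: le_lt_trans (pgf_gt c2 _).
    by rewrite lee_fin y0.
  by rewrite y0.
rewrite gfy; apply: gw_gf_le => //; first exact: ltW.
by rewrite [leRHS]yE lee_wpmul2l ?lee_fin ?(ltW x0)// le12// y_gt0.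
Qed.

(** * Powers as averages over a geometric progression of scales *)

Lemma esum_geometric_int (q : R) : (0 < q < 1)%R ->
  \esum_(k in [set: int]) (q ^+ `|k|%N)%:E < +oo.
Proof.
move=> /andP[q0 q1].
have geo : \sum_(0 <= n <oo) (q ^+ n)%:E <= ((1 - q)^-1)%:E.
  apply: lime_le.
    by apply: is_cvg_nneseries => n _ _; rewrite lee_fin exprn_ge0// ltW.
  apply: nearW => n; rewrite sumEFin lee_fin.
  have := @geometric_le_lim R n 1 q ler01 q0; rewrite mul1r ger0_norm ?(ltW q0)//.
  by move=> /(_ q1); rewrite /series/=; under eq_bigr do rewrite mul1r.
(* The integers split into [Posz n] and [Negz n] = -(n + 1); the second half has terms q^(n+1) <=
   q^n. *)
rewrite (esumID (range Posz)); last first.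
  by move=> k _; rewrite lee_fin exprn_ge0// ltW.
rewrite !setTI (_ : ~` range Posz = range Negz); last first.
  apply/seteqP; split=> [[n []|n _]|_ [n _ <-] []//]; first by exists n.
  by exists n.
rewrite esum_image; last by move=> m n _ _ [].
rewrite esum_image; last by move=> m n _ _ [].
apply: (@le_lt_trans _ _ (((1 - q)^-1)%:E + ((1 - q)^-1)%:E)); last by rewrite ltry.
rewrite nneseries_esumT in geo; last by move=> n; rewrite lee_fin exprn_ge0// ltW.
apply: leeD => //; apply: le_trans geo; apply: le_esum => n _.
by rewrite lee_fin /= exprS ler_piMl ?exprn_ge0 ?ltW.
Qed.

Section LogPeriodic.
Context {b C : R} {H : R -> R}.
Hypothesis b_gt0 : (0 < b)%R.
Hypothesis H_ge0 : forall y, (0 <= H y)%R.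
Hypothesis H_noninc : forall x y, (x <= y)%R -> (H y <= H x)%R.
Hypothesis H_decay :
  forall y, (expR (b * y) * H y <= C * expR (- (b * `|y|)))%R.
Hypothesis H0_gt0 : (0 < H 0)%R.

Let g y := (expR (b * y) * H y)%R.

(** The Mellin integral of [H] in the logarithmic variable, discretised with step [d]. *)
Definition periodization (d x : R) : \bar R :=
  \esum_(k in [set: int]) (g (x + k%:~R * d))%:E.

Let g_ge0 y : (0 <= g y)%R.
Proof. by rewrite mulr_ge0 ?expR_ge0. Qed.

Let periodization_ge0 d x : 0 <= periodization d x.
Proof. by apply: esum_ge0 => k _; rewrite lee_fin. Qed.

Lemma periodization_shift d x (m : int) :
  periodization d (x + m%:~R * d) = periodization d x.
Proof.
rewrite /periodization [RHS](reindex_esum [set: int] _ (fun k => m + k)%R).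
  by apply: eq_esum => k _; rewrite intrD mulrDl addrA.
split=> [//|k l _ _|k _]; first exact: addrI.
by exists (k - m)%R => //; rewrite addrC subrK.
Qed.

(** By periodicity [y] can be moved between [x] and [x + d]; there [H] has not increased and the
    exponential has grown by at most e^(bd). *)
Lemma periodization_quasi_const d x y : (0 < d)%R ->
  periodization d y <= (expR (b * d))%:E * periodization d x.
Proof.
move=> d0; pose m := Num.floor ((y - x) / d).
rewrite -(periodization_shift d y (- m)%R) /periodization -esumZl ?expR_ge0//;
  last by move=> k _; rewrite lee_fin.
have xy : (x <= y + (- m)%:~R * d)%R.
  have := Num.Theory.floor_le ((y - x) / d); rewrite ler_pdivlMr// -/m intrN; lra.
have yx : (y + (- m)%:~R * d <= x + d)%R.
  have := Num.Theory.floorD1_gt ((y - x) / d); rewrite ltr_pdivrMr// -/m.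
  by rewrite intrN intrD; lra.
apply: le_esum => k _; rewrite -EFinM lee_fin /g mulrA -expRD.
apply: ler_pM; rewrite ?expR_ge0//; last by apply: H_noninc; lra.
by rewrite ler_expR -mulrDr ler_pM2l//; lra.
Qed.

(** [H_decay] dominates the terms by a two-sided geometric series of ratio e^(-bd); positivity comes
    from the term k = 0. *)
Lemma periodization_fin d : (0 < d)%R ->
  exists2 r : R, (0 < r)%R & periodization d 0 = r%:E.
Proof.
move=> d0.
have C0 : (0 <= C)%R.
  have := H_decay 0; rewrite mulr0 normr0 mulr0 oppr0 expR0 mul1r mulr1.
  exact: le_trans.
have : 0 < periodization d 0.
  apply: (@lt_le_trans _ _ (g (0 + 0%:~R * d))%:E).
    by rewrite lte_fin mul0r addr0 mulr_gt0// expR_gt0.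
  apply: (esum_ge_term (f := fun k : int => (g (0 + k%:~R * d))%:E)) => // k _.
  by rewrite lee_fin.
have : periodization d 0 < +oo.
  have q01 : (0 < expR (- (b * d)) < 1)%R.
    by rewrite expR_gt0 expR_lt1 oppr_lt0 mulr_gt0.
  apply: (@le_lt_trans _ _
      (C%:E * \esum_(k in [set: int]) (expR (- (b * d)) ^+ `|k|%N)%:E)).
    rewrite -esumZl//.
    apply: le_esum => k _; rewrite -EFinM lee_fin add0r.
    apply: le_trans (H_decay _) _; rewrite -expRM_natl normrM (gtr0_norm d0).
    by rewrite natr_absz intr_norm mulrN mulrCA.
  have := esum_geometric_int q01.
  have : 0 <= \esum_(k in [set: int]) (expR (- (b * d)) ^+ `|k|%N)%:E.
    by apply: esum_ge0 => k _; rewrite lee_fin exprn_ge0// expR_ge0.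
  by case: (esum _ _) => // r _ _; rewrite -EFinM ltry.
by case: (periodization d 0) => // r _; rewrite lte_fin; exists r.
Qed.

(** Tonelli, with e^(-bL) e^(b(L + kd)) = e^(bkd): the weights of the [H]-transforms no longer
    depend on the tree. *)
Lemma esum_periodization (T : choiceType) (L w : T -> R) (d : R) :
  (forall t, 0 <= w t)%R ->
  \esum_(t in [set: T]) ((expR (- (b * L t)) * w t)%:E * periodization d (L t)) =
  \esum_(k in [set: int]) ((expR (b * (k%:~R * d)))%:E *
    \esum_(t in [set: T]) (H (L t + k%:~R * d) * w t)%:E).
Proof.
move=> w0.
under eq_esum => t _.
  rewrite -esumZl; [over|by rewrite mulr_ge0 ?expR_ge0|].
  by move=> k _; rewrite lee_fin.
rewrite esum_exchange; last by move=> t k; rewrite lee_fin !mulr_ge0 ?expR_ge0.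
apply: eq_esum => k _; rewrite -esumZl ?expR_ge0//; last first.
  by move=> t _; rewrite lee_fin mulr_ge0.
apply: eq_esum => t _; rewrite -!EFinM; congr EFin.
rewrite /g mulrDr expRD expRN; field; exact/lt0r_neq0/expR_gt0.
Qed.

(* The [H]-transform at all scales [u = e^y] controls the power [e^(-b L)]:
   averaging [u^b H (L + log u)] over the geometric progression [u = e^(k d)]
   yields [e^(-b L)] times a [d]-periodic function of [L] whose oscillation is at
   most [e^(b d)], and [d] is arbitrary. *)
Lemma power_comparison (T : choiceType) (L w1 w2 : T -> R) :
  (forall t, 0 <= w1 t)%R -> (forall t, 0 <= w2 t)%R ->
  (forall y, \esum_(t in [set: T]) (H (L t + y) * w1 t)%:E <=
             \esum_(t in [set: T]) (H (L t + y) * w2 t)%:E) ->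
  \esum_(t in [set: T]) (expR (- (b * L t)) * w1 t)%:E <=
  \esum_(t in [set: T]) (expR (- (b * L t)) * w2 t)%:E.
Proof.
move=> w10 w20 le12.
have Ew0 w t : (forall t, 0 <= w t)%R -> 0 <= (expR (- (b * L t)) * w t)%:E.
  by move=> w0; rewrite lee_fin mulr_ge0 ?expR_ge0.
apply/lee_mul01Pr; first by apply: esum_ge0 => t _; exact: Ew0.
(* The step [d] makes e^(2bd) = 1/r: one factor e^(bd) is lost in each of the two uses of
   quasi-constancy. *)
move=> r /andP[r0 r1]; pose d := (- ln r / (2 * b))%R.
have d0 : (0 < d)%R by rewrite divr_gt0 ?mulr_gt0// oppr_gt0 ln_lt0// r0.
have rE : (r^-1 = expR (b * d) * expR (b * d))%R.
  rewrite -expRD -[LHS]lnK ?posrE ?invr_gt0// lnV ?posrE//; congr expR.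
  by rewrite /d; field; exact: lt0r_neq0.
rewrite -[leRHS]mul1e -(mulfV (lt0r_neq0 r0)) EFinM -muleA.
rewrite lee_wpmul2l ?lee_fin ?(ltW r0)// rE.
(* Both sides are multiplied by the periodization at 0, the constant to which its values at [L t]
   are compared. *)
have [G0 G0_gt0 GE] := periodization_fin d0.
rewrite -(@lee_pmul2l _ G0%:E)// ?lte_fin//.
set E1 := \esum_(t in _) _; set E2 := \esum_(t in _) _.
apply: (@le_trans _ _ ((expR (b * d))%:E * \esum_(t in [set: T])
    ((expR (- (b * L t)) * w1 t)%:E * periodization d (L t)))).
  rewrite -[leLHS]esumZl ?(ltW G0_gt0)//; last by move=> t _; exact: Ew0.
  rewrite -[leRHS]esumZl ?expR_ge0//; last by move=> t _; rewrite mule_ge0 ?Ew0.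
  apply: le_esum => t _; rewrite [leLHS]muleC muleCA lee_wpmul2l ?Ew0//.
  by rewrite -GE periodization_quasi_const.
rewrite EFinM -muleA muleCA lee_wpmul2l ?lee_fin ?expR_ge0//.
apply: (@le_trans _ _ (\esum_(t in [set: T])
    ((expR (- (b * L t)) * w2 t)%:E * periodization d (L t)))).
  rewrite !esum_periodization//; apply: le_esum => k _.
  by rewrite lee_wpmul2l ?lee_fin ?expR_ge0.
rewrite muleA -EFinM -esumZl ?mulr_ge0 ?expR_ge0 ?(ltW G0_gt0)//; last first.
  by move=> t _; exact: Ew0.
apply: le_esum => t _; rewrite [leRHS]muleC lee_wpmul2l ?Ew0//.
by rewrite mulrC EFinM -GE periodization_quasi_const.
Qed.

End LogPeriodic.

(** * Comparison of the moments of the tree sizes *)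

Lemma psize_gt0 t : (0 < psize t)%N. Proof. by case: t. Qed.

Lemma psize_powRE t (a : R) : ((psize t)%:R `^ a = expR (a * ln (psize t)%:R))%R.
Proof. by rewrite /powR pnatr_eq0 gtn_eqF ?psize_gt0. Qed.

Lemma ln_psize_ge0 t : (0 <= ln (psize t)%:R :> R)%R.
Proof. by rewrite ln_ge0// ler1n psize_gt0. Qed.

(** With L = ln |T| and H(y) = exp(-e^y), this turns the [H]-transform at shift [y] into the
    generating function at exp(-e^y). *)
Lemma expR_psize_scale t (y : R) :
  (expR (- (expR (ln (psize t)%:R + y))) = expR (- expR y) ^+ psize t)%R.
Proof.
rewrite expRD lnK ?posrE ?ltr0n ?psize_gt0// -expRM_natl; congr expR; ring.
Qed.

Section Comparison.
Context {p1 p2 : nat -> R}.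
Hypotheses (crit1 : critical_offspring p1) (crit2 : critical_offspring p2).
Hypothesis pgf_le : forall t : R, (0 < t < 1)%R -> pgf p1 t <= pgf p2 t.

Let w1_ge0 t : (0 <= gw_weight p1 t)%R.
Proof. by apply: gw_weight_ge0; case: crit1. Qed.
Let w2_ge0 t : (0 <= gw_weight p2 t)%R.
Proof. by apply: gw_weight_ge0; case: crit2. Qed.

Let expR_oppexp_itv (y : R) : (0 < expR (- expR y) < 1)%R.
Proof. by rewrite expR_gt0 expR_lt1 oppr_lt0 expR_gt0. Qed.

Lemma gw_mu_neg (alpha : R) : (alpha < 0)%R -> gw_mu p1 alpha <= gw_mu p2 alpha.
Proof.
move=> alpha0; pose b := (- alpha)%R; have b0 : (0 < b)%R by rewrite oppr_gt0.
pose H (y : R) := expR (- expR y).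
have H_ge0 y : (0 <= H y)%R by exact: expR_ge0.
have H_noninc x y : (x <= y)%R -> (H y <= H x)%R.
  by move=> xy; rewrite ler_expR lerN2 ler_expR.
(* For y >= 0 the claim is 2by <= 2b^2 + e^y, which follows from (2b - y)^2 >= 0 and y^2/2 <= e^y;
   hence the constant. *)
have H_decay y : (expR (b * y) * H y <= expR (2 * b ^+ 2) * expR (- (b * `|y|)))%R.
  rewrite -!expRD ler_expR.
  have [y0|y0] := leP 0%R y.
    have := expR_ge1Dxn 1 y0; rewrite (ger0_norm y0) (_ : 2`!%:R = 2%R)//.
    have := sqr_ge0 (2 * b - y)%R; nra.
  have := expR_gt0 y; rewrite (ltr0_norm y0); nra.
have -> : gw_mu p1 alpha = \esum_(t in [set: ptree])
    (expR (- (b * ln (psize t)%:R)) * gw_weight p1 t)%:E.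
  by apply: eq_esum => t _; rewrite psize_powRE /b mulNr opprK.
have -> : gw_mu p2 alpha = \esum_(t in [set: ptree])
    (expR (- (b * ln (psize t)%:R)) * gw_weight p2 t)%:E.
  by apply: eq_esum => t _; rewrite psize_powRE /b mulNr opprK.
apply: (power_comparison b0 H_ge0 H_noninc H_decay (expR_gt0 _)) => // y.
under eq_esum do rewrite /H expR_psize_scale.
under [leRHS]eq_esum do rewrite /H expR_psize_scale.
exact: gw_gf_mono crit1 crit2 pgf_le (expR_oppexp_itv y).
Qed.

(** Here L = -ln |T|, so that e^(-alpha L) = |T|^alpha and H(y) = 1 - exp(-e^(-y)) is nonincreasing;
    passing to the complement exchanges the roles of the two trees. *)
Lemma gw_mu_pos (alpha : R) : (0 < alpha < 2^-1)%R ->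
  gw_mu p2 alpha <= gw_mu p1 alpha.
Proof.
move=> /andP[alpha0 alpha_half].
pose H (y : R) := (1 - expR (- expR (- y)))%R.
have H_gt0 y : (0 < H y)%R.
  by rewrite subr_gt0; case/andP: (expR_oppexp_itv (- y)).
have H_noninc x y : (x <= y)%R -> (H y <= H x)%R.
  by move=> xy; rewrite lerB// ler_expR lerN2 ler_expR lerN2.
have H_decay y :
    (expR (alpha * y) * H y <= 1 * expR (- (alpha * `|y|)))%R.
  rewrite mul1r; have [y0|y0] := leP 0%R y.
    (* From 1 - e^(-v) <= v one gets H(y) <= e^(-y); then alpha - 1 <= -alpha is where alpha < 1/2
       enters. *)
    apply: (@le_trans _ _ (expR (alpha * y) * expR (- y))%R).
      rewrite ler_wpM2l ?expR_ge0// /H.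
      have := expR_ge1Dx (- expR (- y))%R; lra.
    rewrite -expRD ler_expR (ger0_norm y0); nra.
  rewrite (ltr0_norm y0) mulrN opprK ler_piMr ?expR_ge0// /H.
  by have := expR_ge0 (- expR (- y))%R; lra.
have E (p : nat -> R) : gw_mu p alpha = \esum_(t in [set: ptree])
    (expR (- (alpha * (- ln (psize t)%:R))) * gw_weight p t)%:E.
  by apply: eq_esum => t _; rewrite psize_powRE mulrN opprK.
rewrite !E.
apply: (power_comparison alpha0 (fun y => ltW (H_gt0 y)) H_noninc H_decay) => // y.
under eq_esum do rewrite /H opprD opprK expR_psize_scale.
under [leRHS]eq_esum do rewrite /H opprD opprK expR_psize_scale.
have /andP[x0 x1] := expR_oppexp_itv (- y).
apply: (@esum_oneminus _ (fun t => expR (- expR (- y)) ^+ psize t)%R) => //.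
- by move=> t; rewrite exprn_ge0 ?(ltW x0)//= exprn_ile1// ltW.
- exact: gw_weight_sum1 crit1.
- exact: gw_weight_sum1 crit2.
- by apply: (gw_gf_mono crit1 crit2 pgf_le); rewrite x0.
Qed.

(* [ln n] is the increasing limit of [(1 - n^(-b)) / b] as [b] tends to [0]. *)
Lemma gw_mu'_le : gw_mu' p2 <= gw_mu' p1.
Proof.
apply: ge_ereal_sup => _ [X [finX _] <-].
have term_ge0 t : (0 <= ln (psize t)%:R * gw_weight p2 t)%R.
  by rewrite mulr_ge0 ?ln_psize_ge0.
apply/lee_mul01Pr; first by apply: fsume_ge0 => t _; rewrite lee_fin.
move=> r /andP[r0 r1].
(* [K] bounds ln |t| on the finite set [X], so this [b] gives b ln |t| <= 1 - r there; the summand 1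
   keeps the denominator positive. *)
pose K := (\sum_(t <- fset_set X) ln (psize t)%:R : R)%R.
have K0 : (0 <= K)%R by apply: sumr_ge0 => t _; exact: ln_psize_ge0.
pose b := ((1 - r) / (1 + K))%R.
have b0 : (0 < b)%R by rewrite divr_gt0 ?subr_gt0// ltr_pwDl.
pose f t := (expR (- b * ln (psize t)%:R) : R)%R.
have f01 t : (0 <= f t <= 1)%R.
  by rewrite expR_ge0 expR_le1 mulNr oppr_le0 mulr_ge0 ?ln_psize_ge0 ?ltW.
have f_ge t : (b^-1 * (1 - f t) <= ln (psize t)%:R)%R.
  have := expR_ge1Dx (- b * ln (psize t)%:R)%R.
  by rewrite ler_pdivrMl// -/(f t) mulNr; lra.
have f_le t : X t -> (r * ln (psize t)%:R <= b^-1 * (1 - f t))%R.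
  move=> Xt; set l : R := ln (psize t)%:R; have l0 : (0 <= l)%R := ln_psize_ge0 t.
  have lK : (l <= K)%R.
    rewrite /K (bigD1_seq t)//= ?in_fset_set ?inE// lerDl sumr_ge0// => u _.
    exact: ln_psize_ge0.
  have blr : (b * l <= 1 - r)%R.
    by rewrite /b mulrAC ler_pdivrMr ?ltr_pwDl// ler_wpM2l; lra.
  rewrite ler_pdivlMl//.
  (* With z = bl this gives 1 - f >= z / (1 + z) >= rz, because r(1 + z) <= r(2 - r) <= 1. *)
  have : (f t * (1 + b * l) <= 1)%R.
    rewrite /f mulNr expRN mulrC ler_pdivrMr ?expR_gt0// mul1r.
    exact: expR_ge1Dx.
  have : (0 <= b * l)%R by rewrite mulr_ge0// ltW.
  move: blr; rewrite mulrCA; move: (b * l)%R (f t) => z u zr z0 uz.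
  have z1 : (0 < 1 + z)%R by rewrite ltr_pwDl.
  by rewrite -(ler_pM2r z1); nra.
(* This is the negative power case with exponent -b; complementation reverses it below. *)
have f_mean : \esum_(t in [set: ptree]) (f t * gw_weight p1 t)%:E <=
    \esum_(t in [set: ptree]) (f t * gw_weight p2 t)%:E.
  have := gw_mu_neg (alpha := (- b)%R); rewrite oppr_lt0 => /(_ b0).
  by rewrite /gw_mu; under eq_esum do rewrite psize_powRE;
    under [X in _ <= X -> _]eq_esum do rewrite psize_powRE.
have binv0 : (0 <= b^-1)%R by rewrite invr_ge0 ltW.
have f1 t : (0 <= 1 - f t)%R by rewrite subr_ge0; case/andP: (f01 t).
apply: (@le_trans _ _ (b^-1%:E *
    \esum_(t in [set: ptree]) ((1 - f t) * gw_weight p2 t)%:E)).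
  rewrite -esumZl//; last by move=> t _; rewrite lee_fin mulr_ge0.
  rewrite ge0_mule_fsumr; last by move=> t; rewrite lee_fin.
  apply: esum_ge; exists X => //; apply: lee_fsum => // t Xt.
  by rewrite -!EFinM lee_fin !mulrA ler_wpM2r ?f_le.
apply: (@le_trans _ _ (b^-1%:E *
    \esum_(t in [set: ptree]) ((1 - f t) * gw_weight p1 t)%:E)).
  rewrite lee_wpmul2l ?lee_fin//; apply: esum_oneminus => //.
  - exact: gw_weight_sum1 crit1.
  - exact: gw_weight_sum1 crit2.
rewrite -esumZl//; last by move=> t _; rewrite lee_fin mulr_ge0.
by apply: le_esum => t _; rewrite -EFinM lee_fin mulrA ler_wpM2r ?f_ge.
Qed.

End Comparison.

End GaltonWatson.

Theorem theorem6p3 (R : realType) (p1 p2 : nat -> R) :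
  critical_offspring p1 -> critical_offspring p2 ->
  (forall t : R, 0 < t < 1 -> (pgf p1 t <= pgf p2 t)%E) ->
  [/\ (forall alpha : R, alpha < 0 -> (gw_mu p1 alpha <= gw_mu p2 alpha)%E),
      (forall alpha : R, 0 < alpha < 2^-1 -> (gw_mu p2 alpha <= gw_mu p1 alpha)%E)
    & (gw_mu' p2 <= gw_mu' p1)%E].
Proof.
move=> crit1 crit2 pgf_le; split.
- exact: gw_mu_neg.
- exact: gw_mu_pos.
- exact: gw_mu'_le.
Qed.
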